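(* Let $P=(X,\prec)$ be a finite poset, and let $A,B,C\subset\min(P)$ be pairwise disjoint nonempty subsets of minimal elements. Let $f$ be a uniformly random linear extension of $P$ and $f(S):=\{f(s):s\in S\}$ for $S\subseteq X$. Then $$\frac{\mathbb{P}\big[1\in f(C),\,2\in f(C{\uparrow})\big]\cdot\mathbb{P}\big[1\in f(A),\,2\in f(B)\big]}{\mathbb{P}\big[1\in f(A),\,2\in f(C)\big]\cdot\mathbb{P}\big[1\in f(B),\,2\in f(C)\big]}\ \le\ 2.$$ Moreover, there exists a permutation $(A',B',C')$ of $(A,B,C)$ such that $$\frac{\mathbb{P}\big[1\in f(C'),\,2\in f(C'{\uparrow})\big]\cdot\mathbb{P}\big[1\in f(A'),\,2\in f(B')\big]}{\mathbb{P}\big[1\in f(A'),\,2\in f(C')\big]\cdot\mathbb{P}\big[1\in f(B'),\,2\in f(C')\big]}\ \le\ 1.$$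
   Context: A linear extension of a poset $P=(X,\prec)$ with $|X|=n$ is a bijection $f:X\to\{1,\dots,n\}$ such that $u\prec v$ implies $f(u)<f(v)$. Probabilities are with respect to the uniform distribution on linear extensions of $P$. $\min(P)$ is the set of minimal elements of $P$. For $S\subseteq X$, the upper closure is $S{\uparrow}:=\{u\in X:\ u\succcurlyeq s\text{ for some } s\in S\}$. *)

(* Defs.v *)
From mathcomp Require Import all_boot all_order all_algebra.

Set Implicit Arguments.
Unset Strict Implicit.
Unset Printing Implicit Defensive.

Import Order.TTheory GRing.Theory Num.Theory.

Section LinearExtensions.

Context {d : Order.disp_t} {P : finPOrderType d}.

Definition minimals : {set P} := [set x | [forall y, ~~ (y < x)%O]].

Definition upclosure (S : {set P}) : {set P} :=
  [set u | [exists s in S, (s <= u)%O]].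

(* The values {1, ..., n} with n = #|P| are encoded by 'I_n = {0, ..., n - 1}: *)
(* the label of x under f is (f x).+1.                                         *)
Definition is_linext (f : {ffun P -> 'I_#|P|}) : bool :=
  [&& injectiveb f, [forall k, k \in codom f] &
      [forall u, forall v, (u < v)%O ==> (f u < f v)%N]].

Definition linexts : {set {ffun P -> 'I_#|P|}} := [set f | is_linext f].

Definition labels (f : {ffun P -> 'I_#|P|}) (S : {set P}) : seq nat :=
  [seq (f s).+1 | s in S].

Definition prob (E : pred {ffun P -> 'I_#|P|}) : rat :=
  (#|[set f in linexts | E f]|%:R / #|linexts|%:R)%R.

Definition prob12 (S T : {set P}) : rat :=
  prob (fun f => (1 \in labels f S) && (2 \in labels f T)).

Definition cross_ratio (A B C : {set P}) : rat :=
  (prob12 C (upclosure C) * prob12 A B / (prob12 A C * prob12 B C))%R.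

End LinearExtensions.

Arguments minimals {d} P.
Arguments linexts {d} P.

(* Main.v *)
(** Index a symmetric matrix [M] by the minimal elements of [P]: for [x != y],
    [M x y] is the number of linear extensions starting with [x, y], and [M x x]
    is the number of those starting with [x] followed by an element that is
    not minimal in [P], hence lies above [x].  With [g X Y] the value of the
    form [M] on the indicators of [X] and [Y], the probabilities of the theorem
    are, up to a common factor, [g C C], [g A B], [g A C] and [g B C].

    The form [M] has at most one positive eigenvalue, by induction on [P].  The
    row of [M] at [x] is the form of [P - x] paired with the constant [1], so
    the reverse Cauchy-Schwarz inequality for all the posets [P - x] bounds
    [sum_x (M v)_x^2 / d_x] from below by [<v, M v>], where [d = M 1].  Thus
    [N = D^-1 M], with [D = diag d], satisfies [N <= N^2]; since [1 - N] is the
    Laplacian of a complete weighted graph, [N] is nonpositive on the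
    orthogonal of the constants.

    Reverse Cauchy-Schwarz for [C] and [g B C * A + g A C * B] gives
    [g C C * g A B <= 2 * g A C * g B C].  If moreover
    [g C C * g A B > g A C * g B C], then [g A A * g C C <= g A C ^ 2] gives
    [g A A * g B C <= g A B * g A C]. *)

Require Import Defs.
From mathcomp Require Import all_boot all_order all_algebra.
From mathcomp Require Import ring lra.

Set Implicit Arguments.
Unset Strict Implicit.
Unset Printing Implicit Defensive.

Import Order.TTheory GRing.Theory Num.Theory.
Local Open Scope ring_scope.

(** * Linear systems and Laplacians of complete weighted graphs *)

Lemma injective_solvable (F : fieldType) (T : finType) (A : {set T})
    (L : T -> T -> F) :
  (forall v : T -> F, (forall x, x \in A -> \sum_(y in A) L x y * v y = 0) ->
     forall x, x \in A -> v x = 0) ->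
  forall u : T -> F, exists v : T -> F,
    forall x, x \in A -> \sum_(y in A) L x y * v y = u x.
Proof.
move=> inj u.
have [->|[x0 Ax0]] := set_0Vmem A; first by exists u => x; rewrite inE.
(* The transpose of [L], since it acts on row vectors from the right. *)
pose M := \matrix_(j < #|A|, i < #|A|) L (enum_val i) (enum_val j).
pose ext (r : 'rV[F]_#|A|) x : F := r 0 (enum_rank_in Ax0 x).
have extE r x : x \in A ->
    \sum_(y in A) L x y * ext r y = (r *m M) 0 (enum_rank_in Ax0 x).
  move=> Ax; rewrite mxE big_enum_val; apply: eq_bigr => i _.
  by rewrite mxE enum_rankK_in // /ext enum_valK_in mulrC.
have Mu : M \in unitmx.
  rewrite -row_free_unit -kermx_eq0; apply/rowV0P => r /sub_kermxP rM0.
  apply/rowP => i; rewrite mxE -(enum_valK_in Ax0 i).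
  apply: (inj (ext r) _ _ (enum_valP i)) => x Ax.
  by rewrite extE // rM0 mxE.
exists (ext ((\row_i u (enum_val i)) *m invmx M)) => x Ax.
by rewrite extE // mulmxKV // mxE enum_rankK_in.
Qed.

Section Laplacian.

Variables (F : realFieldType) (T : finType) (A : {set T}) (w : T -> T -> F).
Hypothesis wC : forall x y, x \in A -> y \in A -> w x y = w y x.
Hypothesis w_gt0 : forall x y, x \in A -> y \in A -> x != y -> 0 < w x y.

Let d x := \sum_(y in A) w x y.
Let lap (v : T -> F) x := \sum_(y in A) w x y * (v x - v y).

Let lapE v x : lap v x = d x * v x - \sum_(y in A) w x y * v y.
Proof.
rewrite /lap /d mulr_suml -sumrB; apply: eq_bigr => y _; ring.
Qed.

Let lap_swap u v :
  \sum_(x in A) u x * lap v x =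
  \sum_(x in A) \sum_(y in A) w x y * (u y * (v y - v x)).
Proof.
rewrite exchange_big /=; apply: eq_bigr => x Ax.
rewrite /lap mulr_sumr; apply: eq_bigr => y Ay; rewrite (wC Ay Ax); ring.
Qed.

(** Averaging the sum with its copy from [lap_swap] gives the Dirichlet form, which shows symmetry,
    positivity and the kernel of [lap]. *)
Let lap_dirichlet u v :
  2 * (\sum_(x in A) u x * lap v x) =
  \sum_(x in A) \sum_(y in A) w x y * ((u x - u y) * (v x - v y)).
Proof.
rewrite mulr_natl mulr2n {1}lap_swap -big_split; apply: eq_bigr => x Ax /=.
rewrite /lap mulr_sumr -big_split; apply: eq_bigr => y Ay /=; ring.
Qed.

Let lapC u v : \sum_(x in A) u x * lap v x = \sum_(x in A) v x * lap u x.
Proof.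
apply: (@mulfI _ 2); first by rewrite pnatr_eq0.
rewrite !lap_dirichlet; apply: eq_bigr => x _; apply: eq_bigr => y _; ring.
Qed.

Let dir_ge0 v x y : x \in A -> y \in A -> 0 <= w x y * ((v x - v y) * (v x - v y)).
Proof.
move=> Ax Ay; have [->|nxy] := eqVneq x y; first by rewrite subrr !mulr0.
by rewrite mulr_ge0 ?sqr_ge0 ?ltW ?w_gt0 // -expr2 sqr_ge0.
Qed.

Let lap_ge0 v : 0 <= \sum_(x in A) v x * lap v x.
Proof.
rewrite -(pmulr_rge0 _ (ltr0n F 2)) lap_dirichlet.
by apply: sumr_ge0 => x Ax; apply: sumr_ge0 => y Ay; apply: dir_ge0.
Qed.

Let lap_eq0 v : \sum_(x in A) v x * lap v x = 0 ->
  forall x y, x \in A -> y \in A -> v x = v y.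
Proof.
move=> l0 x y Ax Ay; have [->//|nxy] := eqVneq x y.
have := lap_dirichlet v v; rewrite l0 mulr0 => /esym/eqP.
rewrite psumr_eq0; last by move=> i Ai; apply: sumr_ge0 => j Aj; apply: dir_ge0.
move=> /allP/(_ x (mem_index_enum _)); rewrite Ax /=.
rewrite psumr_eq0; last by move=> j Aj; apply: dir_ge0.
move=> /allP/(_ y (mem_index_enum _)); rewrite Ay /=.
by rewrite !mulf_eq0 orbb (gt_eqF (w_gt0 Ax Ay nxy)) /= subr_eq0 => /eqP.
Qed.

Let lap1 v : \sum_(x in A) lap v x = 0.
Proof.
have -> : \sum_(x in A) lap v x = \sum_(x in A) 1 * lap v x.
  by apply: eq_bigr => x _; rewrite mul1r.
rewrite lapC big1 // => x _; rewrite [lap _ _]big1 ?mulr0 // => y _.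
by rewrite subrr mulr0.
Qed.

(* Adding the all-ones matrix makes the Laplacian positive definite. *)
Let lap_solvable (u : T -> F) : \sum_(x in A) u x = 0 ->
  exists v, forall x, x \in A -> lap v x = u x.
Proof.
move=> u0.
pose L x y : F := (if x == y then d x else 0) - w x y + 1.
have LE v x : x \in A ->
    \sum_(y in A) L x y * v y = lap v x + \sum_(y in A) v y.
  move=> Ax; rewrite lapE.
  have -> : d x * v x = \sum_(y in A) (if x == y then d x else 0) * v y.
    rewrite (bigD1 x) //= eqxx big1 ?addr0 // => y /andP[_ nyx].
    by rewrite eq_sym (negPf nyx) mul0r.
  rewrite -sumrB -big_split; apply: eq_bigr => y _ /=; rewrite /L; case: ifP => _; ring.
have card_neq0 x : x \in A -> #|A|%:R != 0 :> F.
  by move=> Ax; rewrite pnatr_eq0 -lt0n; apply/card_gt0P; exists x.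
have [v Hv|v Hv] := @injective_solvable F T A L _ u.
  move=> x Ax; set s := \sum_(y in A) v y.
  have lap_s y : y \in A -> lap v y = - s.
    by move=> Ay; apply/eqP; rewrite -addr_eq0 -LE // Hv.
  (* A Laplacian sums to zero, so [#|A| * s = 0]. Then [lap v = 0], and [v] is constant with zero
     sum. *)
  have s0 : s = 0.
    have := lap1 v; rewrite (eq_bigr _ lap_s) sumr_const -mulr_natr => /eqP.
    by rewrite mulf_eq0 (negPf (card_neq0 _ Ax)) orbF oppr_eq0 => /eqP.
  have v_const y : y \in A -> v y = v x.
    move=> Ay; apply: lap_eq0 => //; apply: big1 => z Az.
    by rewrite lap_s // s0 oppr0 mulr0.
  move: s0; rewrite /s (eq_bigr _ v_const) sumr_const -mulr_natr => /eqP.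
  by rewrite mulf_eq0 (negPf (card_neq0 _ Ax)) orbF => /eqP.
exists v => x Ax; set s := \sum_(y in A) v y.
have : \sum_(y in A) (lap v y + s) = 0.
  by rewrite -[RHS]u0; apply: eq_bigr => y Ay; rewrite -LE // Hv.
rewrite big_split /= lap1 add0r sumr_const -mulr_natr => /eqP.
rewrite mulf_eq0 (negPf (card_neq0 _ Ax)) orbF => /eqP s0.
by rewrite -Hv // LE // -/s s0 addr0.
Qed.

(* With [K = 1 - D^-1 w], self-adjoint for [D = diag d], the hypothesis reads
   [K <= K^2]; as [K > 0] on the complement of the constants, [1 <= K] there. *)
Lemma nonpos_on_hyperplane :
  (forall x, x \in A -> 0 < d x) ->
  (forall v : T -> F,
     \sum_(x in A) v x * (\sum_(y in A) w x y * v y) <=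
     \sum_(x in A) (\sum_(y in A) w x y * v y) ^+ 2 / d x) ->
  forall u : T -> F, \sum_(x in A) d x * u x = 0 ->
    \sum_(x in A) u x * (\sum_(y in A) w x y * u y) <= 0.
Proof.
move=> d_gt0 expand u u0.
(* Here [lap v x = d x * u x], that is, [u = K v]. *)
have [v Hv] := lap_solvable u0.
have rowE z x : \sum_(y in A) w x y * z y = d x * z x - lap z x.
  by rewrite lapE opprB addrCA subrr addr0.
pose N := \sum_(x in A) d x * u x ^+ 2.
have uv : \sum_(x in A) u x * lap v x = N.
  by apply: eq_bigr => x Ax; rewrite Hv // expr2 mulrCA.
(* This is [K <= K^2] evaluated at [v]. *)
have vv : \sum_(x in A) v x * lap v x <= N.
  have := expand v; rewrite -subr_ge0 -sumrB => h.
  rewrite -subr_ge0; apply: le_trans h _; rewrite -sumrB le_eqVlt; apply/orP; left.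
  apply/eqP/eq_bigr => x Ax; rewrite rowE Hv //; field.
  by rewrite (gt_eqF (d_gt0 _ Ax)).
(* Positivity of [lap] at [u - v]; together with [vv] it bounds the energy of [u] below by [N]. *)
have uu : 0 <= \sum_(x in A) u x * lap u x - 2 * N + \sum_(x in A) v x * lap v x.
  rewrite -{1}uv mulr_natl mulr2n {2}lapC opprD addrA -!sumrB -big_split /=.
  apply: le_trans (lap_ge0 (fun x => u x - v x)) _; rewrite le_eqVlt; apply/orP; left.
  apply/eqP/eq_bigr => x Ax.
  have -> : lap (fun x => u x - v x) x = lap u x - lap v x.
    by rewrite /lap -sumrB; apply: eq_bigr => y _; ring.
  ring.
have -> : \sum_(x in A) u x * (\sum_(y in A) w x y * u y) =
    N - \sum_(x in A) u x * lap u x.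
  by rewrite -sumrB; apply: eq_bigr => x _; rewrite rowE; ring.
lra.
Qed.

End Laplacian.

(** * The form [M] of a subposet and its reverse Cauchy-Schwarz inequality *)

Section Atlas.

Context {d : Order.disp_t} {P : finPOrderType d}.
Implicit Types (S : {set P}) (u v : P -> rat).

Definition mins S : {set P} := [set x in S | [forall y in S, ~~ (y < x)%O]].

Lemma minsP S x :
  reflect (x \in S /\ forall y, y \in S -> ~~ (y < x)%O) (x \in mins S).
Proof.
rewrite inE; apply: (iffP andP) => -[xS] => [/forall_inP|] H; split=> //.
exact/forall_inP.
Qed.

Lemma minsT : mins setT = minimals P.
Proof.
apply/setP => x; rewrite !inE /=; apply: eq_forallb => y.
by rewrite inE.
Qed.

Lemma mins_sub S S' x : S' \subset S -> x \in S' -> x \in mins S -> x \in mins S'.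
Proof.
move=> sS xS' /minsP[_ H]; apply/minsP; split=> // y /(subsetP sS); exact: H.
Qed.

Lemma minsD1 S x y : y \in mins S -> y != x -> y \in mins (S :\ x).
Proof.
move=> yS nyx; apply: (mins_sub _ _ yS); first exact: subD1set.
by rewrite in_setD1 nyx; case/minsP: yS.
Qed.

(** An element of [S] below [y] and other than [x] would survive in [S :\ x], so only [x] can have
    kept [y] from being minimal. *)
Lemma new_min_gt S x y : y \in mins (S :\ x) -> y \notin mins S -> (x < y)%O.
Proof.
move=> /minsP[/setD1P[_ yS] H]; apply: contraR => nxy; apply/minsP; split=> // z zS.
have [->//|nzx] := eqVneq z x; by rewrite H // in_setD1 nzx.
Qed.

Lemma mins_neq0 S : S != set0 -> mins S != set0.
Proof.
move=> /set0Pn[x0 x0S]; apply/set0Pn.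
case: (@arg_minnP P x0 (mem S) (fun x => #|[set y in S | (y < x)%O]|) x0S) => x xS xmin.
exists x; apply/minsP; split=> // y yS; apply/negP => ltyx.
have := xmin y yS; rewrite leqNgt => /negP; apply; apply: proper_card.
apply/properP; split; last by exists y; rewrite !inE ?yS ?ltyx ?ltxx.
apply/subsetP => z; rewrite !inE => /andP[-> /lt_trans]; exact.
Qed.

(* [numext_rec #|S| S] counts the linear extensions of the subposet [S]. *)
Fixpoint numext_rec n S : rat :=
  if n is n'.+1 then \sum_(x in mins S) numext_rec n' (S :\ x) else 1.

Definition numext S : rat := numext_rec #|S| S.

Lemma numext0 : numext set0 = 1.
Proof. by rewrite /numext cards0. Qed.

Lemma numextE S : S != set0 -> numext S = \sum_(x in mins S) numext (S :\ x).
Proof.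
rewrite -card_gt0 {1}/numext; case E: #|S| => [//|n] _ /=.
apply: eq_bigr => x /minsP[xS _]; rewrite /numext.
by move: E; rewrite (cardsD1 x) xS add1n => -[->].
Qed.

Lemma numext_gt0 S : 0 < numext S.
Proof.
move E: #|S| => n; elim: n S E => [|n IHn] S E.
  by rewrite (cards0_eq E) numext0.
have S0 : S != set0 by rewrite -card_gt0 E.
have pos x : x \in mins S -> 0 < numext (S :\ x).
  by move=> /minsP[xS _]; apply: IHn; move: E; rewrite (cardsD1 x) xS add1n => -[].
rewrite numextE // lt_def sumr_ge0 ?andbT => [|x /pos/ltW//].
rewrite psumr_neq0 => [|x /pos/ltW//].
have /set0Pn[x xS] := mins_neq0 S0.
by apply/hasP; exists x; rewrite ?mem_index_enum // xS pos.
Qed.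

(* A function on [mins S] transported to [mins (S :\ x)]: the elements that
   become minimal with the removal of [x] inherit the value at [x]. *)
Definition transport S x v y := if y \in mins S then v y else v x.

Definition atlas_row S v x :=
  \sum_(y in mins (S :\ x)) numext (S :\ x :\ y) * transport S x v y.

Definition atlas_form S u v := \sum_(x in mins S) u x * atlas_row S v x.

Definition atlas_mx S x y : rat :=
  if x == y then \sum_(z in mins (S :\ x) | z \notin mins S) numext (S :\ x :\ z)
  else numext (S :\ x :\ y).

Lemma setD1C S x y : S :\ x :\ y = S :\ y :\ x.
Proof. by rewrite !setDDl setUC. Qed.

Lemma atlas_mxC S x y : atlas_mx S x y = atlas_mx S y x.
Proof. by rewrite /atlas_mx eq_sym setD1C; case: eqP => // ->. Qed.

(** The second elements freed by [x] all carry the value [v x]; together they make up the diagonal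
    entry. *)
Lemma rowE S v x : x \in mins S ->
  atlas_row S v x = \sum_(y in mins S) atlas_mx S x y * v y.
Proof.
move=> xS; rewrite /atlas_row (bigID (mem (mins S))) /= addrC (bigD1 x xS) /=.
rewrite {1}/atlas_mx eqxx mulr_suml; congr (_ + _).
  by apply: eq_bigr => y /andP[_ /negPf yS]; rewrite /transport yS.
apply: eq_big => [y|y /andP[yx yS]].
  have [->|nyx] := eqVneq y x; first by rewrite andbF !inE eqxx.
  rewrite andbT; case yS: (y \in mins S); last by rewrite andbF.
  by rewrite minsD1.
rewrite /transport yS /atlas_mx; case: eqP => // E.
by rewrite -E !inE eqxx in yx.
Qed.

Lemma form_mx S u v :
  atlas_form S u v =
  \sum_(x in mins S) \sum_(y in mins S) atlas_mx S x y * (u x * v y).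
Proof.
apply: eq_bigr => x xS; rewrite rowE // mulr_sumr.
by apply: eq_bigr => y _; rewrite mulrCA.
Qed.

Lemma formC S u v : atlas_form S u v = atlas_form S v u.
Proof.
rewrite !form_mx exchange_big; apply: eq_bigr => x _; apply: eq_bigr => y _.
by rewrite atlas_mxC [u _ * _]mulrC.
Qed.

Lemma form_linear S (a b : rat) u u' v :
  atlas_form S (fun x => a * u x + b * u' x) v =
  a * atlas_form S u v + b * atlas_form S u' v.
Proof.
rewrite /atlas_form !mulr_sumr -big_split; apply: eq_bigr => x _ /=; ring.
Qed.

Lemma row1 S x : S :\ x != set0 -> atlas_row S (fun=> 1) x = numext (S :\ x).
Proof.
move=> Sx0; rewrite numextE //; apply: eq_bigr => y _.
by rewrite /transport if_same mulr1.
Qed.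

Lemma form1 S v : (1 < #|S|)%N ->
  atlas_form S v (fun=> 1) = \sum_(x in mins S) numext (S :\ x) * v x.
Proof.
move=> S1; apply: eq_bigr => x /minsP[xS _]; rewrite mulrC row1 //.
by move: S1; rewrite (cardsD1 x) xS ltnS card_gt0.
Qed.

(** This drives the induction on [#|S|]. The form counts words of two letters, so [S :\ x] must have
    at least two elements. *)
Lemma row_form S v x : (2 < #|S|)%N -> x \in mins S ->
  atlas_row S v x = atlas_form (S :\ x) (transport S x v) (fun=> 1).
Proof.
move=> S2 /minsP[xS _]; rewrite form1 //.
by move: S2; rewrite (cardsD1 x) xS ltnS.
Qed.

(* A sum over the words [x, y, z] of the first three elements.  It vanishes
   after symmetrisation, except for the words whose third element is freed
   only by the removal of both [x] and [y]: these contribute [(v y - v x)^2]. *)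
Lemma pullback S v : (2 < #|S|)%N ->
  atlas_form S v v <=
  \sum_(x in mins S) atlas_form (S :\ x) (transport S x v) (transport S x v).
Proof.
move=> S2; rewrite -subr_ge0 -sumrB.
pose E x y z := numext (S :\ x :\ y :\ z).
have E12 x y z : E x y z = E y x z by rewrite /E [S :\ x :\ y]setD1C.
have E23 x y z : E x y z = E x z y by rewrite /E setD1C.
have E13 x y z : E x y z = E z y x by rewrite E12 E23 E12.
pose m := mins S.
pose fresh x y := (y \in mins (S :\ x)) && (y \notin m).
pose fresh2 x y z := [&& z \in mins (S :\ x :\ y), z \notin mins (S :\ x)
  & z \notin mins (S :\ y)].
(* The words that can contribute, by how their letters become available: all three minimal in [S]
   ([G1]), the second freed by the first ([G2]), the third freed by the second ([G3]), the third
   freed only by both ([G4]). In the remaining words the difference of transported values is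
   zero. *)
pose G1 x y z := if [&& x \in m, y \in m, z \in m, x != y, x != z & y != z]
  then E x y z * (v y * (v z - v x)) else 0.
pose G2 x y z := if [&& x \in m, fresh x y, z \in m & x != z]
  then E x y z * (v x * (v z - v x)) else 0.
pose G3 x y z := if [&& x \in m, y \in m, x != y & fresh y z]
  then E x y z * (v y * (v y - v x)) else 0.
pose G4 x y z := if [&& x \in m, y \in m, x != y & fresh2 x y z]
  then E x y z * (v y * (v y - v x)) else 0.
(* If [x] frees [z] then [x < z], so [z] is not minimal while [x] is present. *)
have freshN x y z : x \in m -> x != y -> fresh x z -> z \notin mins (S :\ y).
  move=> /minsP[xS _] nxy /andP[zx zm]; apply/minsP => -[_ /(_ x)].
  by rewrite in_setD1 nxy xS (new_min_gt zx zm) => /(_ isT).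
rewrite [X in _ <= X](_ : _ =
  \sum_x \sum_y \sum_z (G1 x y z + (G2 x y z + G3 x y z) + G4 x y z)); last first.
  rewrite big_mkcond; apply: eq_bigr => x _.
  transitivity (\sum_y \sum_z if [&& x \in m, y \in mins (S :\ x)
      & z \in mins (S :\ x :\ y)] then E x y z * (transport S x v y *
        ((if z \in mins (S :\ x) then transport S x v z else transport S x v y)
         - v x)) else 0).
    case: ifP => xm; last first.
      by rewrite big1 // => y _; rewrite big1.
    rewrite mulr_sumr -sumrB big_mkcond; apply: eq_bigr => y _ /=.
    case: ifP => ym; last by rewrite big1.
    have [/minsP[xS _] /minsP[yS _]] := (xm, ym).
    (* Expanding [numext (S :\ x :\ y)] over the third element puts both forms on the same words. *)
    rewrite -big_mkcond /= numextE; last first.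
      rewrite -card_gt0; move: S2; rewrite (cardsD1 x) xS.
      by rewrite [#|S :\ x|](cardsD1 y) yS.
    rewrite /atlas_row !(mulr_suml, mulr_sumr) -sumrB; apply: eq_bigr => z _.
    rewrite /E -/(transport _ y (transport S x v) z); ring.
  apply: eq_bigr => y _; apply: eq_bigr => z _.
  rewrite /G1 /G2 /G3 /G4.
  case xm: (x \in m) => //=.
  have [->|nxy] := eqVneq x y.
    by rewrite /fresh !inE eqxx /= !andbF !addr0.
  case ym: (y \in m) => /=; last first.
    rewrite !addr0 add0r /fresh ym andbT /transport -/m ym.
    case: (y \in mins (S :\ x)) => //=.
    case zm: (z \in m) => /=; last by rewrite if_same subrr !mulr0 if_same.
    have [->|nxz] := eqVneq x z; first by rewrite !inE eqxx !andbF.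
    have zx : z \in mins (S :\ x) by rewrite minsD1 // eq_sym.
    by rewrite zx minsD1 //; apply: contraTneq zm => ->; rewrite ym.
  rewrite (minsD1 ym) 1?eq_sym // /fresh ym !andbF add0r /transport -/m ym /=.
  case zm: (z \in m) => /=.
    rewrite andbF addr0 /fresh2.
    have [->|nxz] := eqVneq x z; first by rewrite !inE eqxx !andbF addr0.
    have zx : z \in mins (S :\ x) by rewrite minsD1 // eq_sym.
    rewrite zx /= andbF addr0.
    have [->|nyz] := eqVneq y z; first by rewrite !inE eqxx.
    by rewrite minsD1 // eq_sym.
  rewrite add0r andbT /fresh2.
  case zx: (z \in mins (S :\ x)) => /=.
    rewrite subrr !mulr0 if_same andbF addr0.
    by rewrite (negPf (freshN x y z xm nxy _)) // /fresh zx zm.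
  case zy: (z \in mins (S :\ y)) => /=; last by rewrite andbT add0r.
  rewrite andbF addr0 setD1C minsD1 //.
  by apply: contraTneq xm => <-; rewrite zm.
pose sum3 (G : P -> P -> P -> rat) := \sum_x \sum_y \sum_z G x y z.
have sum3D G G' : sum3 (fun x y z => G x y z + G' x y z) = sum3 G + sum3 G'.
  rewrite /sum3 -big_split; apply: eq_bigr => x _ /=.
  by rewrite -big_split; apply: eq_bigr => y _ /=; rewrite big_split.
have sum3_12 G : sum3 G = sum3 (fun x y z => G y x z) by apply: exchange_big.
have sum3_23 G : sum3 G = sum3 (fun x y z => G x z y).
  by apply: eq_bigr => x _; apply: exchange_big.
have sum3_13 G : sum3 G = sum3 (fun x y z => G z y x).
  rewrite (sum3_12 G) (sum3_23 (fun x y z => G y x z)).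
  by rewrite (sum3_12 (fun x y z => G z x y)).
have sum3_ge0 G : (forall x y z, 0 <= G x y z + G y x z) -> 0 <= sum3 G.
  move=> G0; rewrite -(pmulr_rge0 _ (ltr0n rat 2)) mulr_natl mulr2n {2}sum3_12.
  by rewrite -sum3D; do 3![apply: sumr_ge0 => ? _].
rewrite -/(sum3 _) !sum3D.
(* Rotating the word cyclically turns [G2] into the opposite of [G3]. *)
have -> : sum3 G2 + sum3 G3 = 0.
  rewrite (sum3_23 G2) (sum3_12 (fun x y z => _)) -sum3D.
  rewrite /sum3 big1 // => x _; rewrite big1 // => y _; rewrite big1 // => z _.
  rewrite /G2 /G3 [y == x]eq_sym.
  case: (x \in m); case: (y \in m); case: (x != y); case: (fresh _ _);
    rewrite //= ?addr0 //.
  by rewrite E23 E12; ring.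
(* [G1] changes sign when the first and third letters are exchanged. *)
have -> : sum3 G1 = 0.
  apply: (@mulfI _ 2) => //; rewrite mulr0 mulr_natl mulr2n.
  rewrite {2}sum3_13 -sum3D.
  rewrite /sum3 big1 // => x _; rewrite big1 // => y _; rewrite big1 // => z _.
  rewrite /G1 [y == x]eq_sym [z == x]eq_sym [z == y]eq_sym.
  case: (x \in m); case: (y \in m); case: (z \in m); case: (x != y);
    case: (y != z); case: (x != z); rewrite //= ?addr0 //.
  by rewrite [E z y x]E13; ring.
rewrite !add0r; apply: sum3_ge0 => x y z; rewrite /G4 [y == x]eq_sym.
have -> : fresh2 y x z = fresh2 x y z.
  by rewrite /fresh2 setD1C; congr andb; rewrite andbC.
case: (x \in m); case: (y \in m); case: (x != y); case: (fresh2 _ _ _);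
  rewrite //= ?addr0 //.
rewrite [E y x z]E12.
have -> : E x y z * (v y * (v y - v x)) + E x y z * (v x * (v x - v y)) =
    E x y z * (v y - v x) ^+ 2 by ring.
by rewrite mulr_ge0 ?sqr_ge0 // ltW // numext_gt0.
Qed.

(** The inequality assumed for each [S :\ x], divided by its value at the constants
    [numext (S :\ x) = d x], turns [pullback] into the hypothesis of [nonpos_on_hyperplane]. *)
Lemma form_nonpos S u : (2 < #|S|)%N ->
  (forall x v, x \in mins S ->
     atlas_form (S :\ x) v v * atlas_form (S :\ x) (fun=> 1) (fun=> 1) <=
     atlas_form (S :\ x) v (fun=> 1) ^+ 2) ->
  atlas_form S u (fun=> 1) = 0 -> atlas_form S u u <= 0.
Proof.
move=> S2 hyp u0.
have cardD1 x : x \in mins S -> (1 < #|S :\ x|)%N.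
  by move=> /minsP[xS _]; move: S2; rewrite (cardsD1 x) xS.
have degE x : x \in mins S -> \sum_(y in mins S) atlas_mx S x y = numext (S :\ x).
  move=> xS; rewrite -row1; last by rewrite -card_gt0 ltnW // cardD1.
  by rewrite rowE //; apply: eq_bigr => y _; rewrite mulr1.
have form_row v v' : \sum_(x in mins S) v x * (\sum_(y in mins S) atlas_mx S x y * v' y)
    = atlas_form S v v'.
  by apply: eq_bigr => x xS; rewrite rowE.
rewrite -form_row; apply: nonpos_on_hyperplane => [x y _ _|x y _ _ nxy|x xS|v|].
- exact: atlas_mxC.
- by rewrite /atlas_mx (negPf nxy) numext_gt0.
- by rewrite degE ?numext_gt0.
- rewrite form_row; apply: le_trans (pullback v S2) _; apply: ler_sum => x xS.
  rewrite degE // -rowE // row_form // ler_pdivlMr ?numext_gt0 //.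
  apply: le_trans (hyp _ _ xS); rewrite le_eqVlt; apply/orP; left; apply/eqP.
  congr (_ * _); rewrite form1 ?cardD1 // numextE; last by rewrite -card_gt0 ltnW // cardD1.
  by apply: eq_bigr => y _; rewrite mulr1.
- rewrite -[RHS]u0 form1 1?ltnW //; apply: eq_bigr => x xS.
  by rewrite degE.
Qed.

(** With one minimal element there is equality. Two minimal elements exhaust [S], so the diagonal
    vanishes and the defect is a square. *)
Lemma form_small S v : (#|S| <= 2)%N ->
  atlas_form S v v * atlas_form S (fun=> 1) (fun=> 1) <= atlas_form S v (fun=> 1) ^+ 2.
Proof.
move=> S2.
have [m0|[x xm]] := set_0Vmem (mins S).
  by rewrite /atlas_form m0 !big_set0 mul0r expr0n.
have [m1|[y]] := set_0Vmem (mins S :\ x).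
  have {}m1 : mins S = [set x] by rewrite -(setD1K xm) m1 setU0.
  rewrite !form_mx m1 !big_set1 le_eqVlt; apply/orP; left; apply/eqP; ring.
rewrite in_setD1 => /andP[nyx ym].
have sxy : [set x; y] \subset mins S.
  by apply/subsetP => z /set2P[]->.
have smS : mins S \subset S by apply/subsetP => z /minsP[].
have xyS : [set x; y] = S.
  apply/eqP; rewrite eqEcard (subset_trans sxy smS) cards2 eq_sym nyx.
  exact: S2.
have mS : mins S = [set x; y].
  by apply/eqP; rewrite eqEsubset sxy andbT xyS.
have diag z : atlas_mx S z z = 0.
  rewrite /atlas_mx eqxx big1 // => t /andP[/minsP[/setD1P[_ tS] _]].
  by rewrite mS xyS tS.
have sum2 F : \sum_(z in [set x; y]) F z = F x + F y :> rat.
  by rewrite big_setU1 ?inE 1?eq_sym //= big_set1.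
rewrite !form_mx mS !sum2 !diag.
rewrite [atlas_mx S y x]atlas_mxC -subr_ge0; set c := atlas_mx S x y.
rewrite [X in 0 <= X](_ : _ = (c * (v x - v y)) ^+ 2) ?sqr_ge0 //; ring.
Qed.

Lemma form11_gt0 S : (1 < #|S|)%N -> 0 < atlas_form S (fun=> 1) (fun=> 1).
Proof.
move=> S1; rewrite form1 //; under eq_bigr do rewrite mulr1.
by rewrite -numextE ?numext_gt0 // -card_gt0 ltnW.
Qed.

Theorem form_hyperbolic1 S v :
  atlas_form S v v * atlas_form S (fun=> 1) (fun=> 1) <= atlas_form S v (fun=> 1) ^+ 2.
Proof.
move E: #|S| => n; elim: n S v E => [|n IHn] S v E.
  by apply: form_small; rewrite E.
have [?|S2] := leqP #|S| 2; first exact: form_small.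
have a_gt0 := form11_gt0 (ltnW S2).
set a := atlas_form S (fun=> 1) (fun=> 1) in a_gt0 *; set b := atlas_form S v (fun=> 1).
(* The projection of [v] to the orthogonal of the constants, scaled by [a] to avoid division. *)
pose u x := a * v x + (- b) * 1.
have u0 : atlas_form S u (fun=> 1) = 0.
  by rewrite /u form_linear -/a -/b; ring.
have uu : atlas_form S u u = a * (atlas_form S v v * a - b ^+ 2).
  rewrite {1}/u form_linear [atlas_form S (fun=> 1) u]formC u0 [atlas_form S v u]formC.
  by rewrite /u form_linear [atlas_form S (fun=> 1) v]formC -/b; ring.
rewrite -subr_le0 -(pmulr_rle0 _ a_gt0) -uu; apply: form_nonpos => // x w xS.
by apply: IHn; move: E; case/minsP: xS => xS _; rewrite (cardsD1 x) xS => -[].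
Qed.

Theorem form_hyperbolic S u w : (1 < #|S|)%N ->
  0 <= atlas_form S w w -> atlas_form S u u * atlas_form S w w <= atlas_form S u w ^+ 2.
Proof.
move=> S1; rewrite le_eqVlt => /orP[/eqP<-|ww]; first by rewrite mulr0 sqr_ge0.
have a_gt0 := form11_gt0 S1.
set q := atlas_form S w w in ww *; set r := atlas_form S u w.
pose b := atlas_form S u (fun=> 1); pose p := atlas_form S w (fun=> 1).
have p_gt0 : 0 < p ^+ 2.
  by apply: lt_le_trans (form_hyperbolic1 S w); rewrite mulr_gt0.
(* The combination of [u] and [w] orthogonal to the constants; the form is nonpositive there because
   its value at the constants is positive. *)
pose z x := p * u x + (- b) * w x.
have z1 : atlas_form S z (fun=> 1) = 0 by rewrite /z form_linear -/b -/p; ring.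
have zz : atlas_form S z z = p ^+ 2 * atlas_form S u u - 2 * p * b * r + b ^+ 2 * q.
  rewrite {1}/z form_linear ![atlas_form S _ z]formC /z !form_linear.
  by rewrite [atlas_form S w u]formC -/q -/r; ring.
have z_le0 : atlas_form S z z <= 0.
  have := form_hyperbolic1 S z; rewrite z1 expr0n /=.
  by rewrite pmulr_lle0.
rewrite -subr_le0 -(pmulr_rle0 _ p_gt0).
have -> : p ^+ 2 * (atlas_form S u u * q - r ^+ 2) =
    q * atlas_form S z z - (b * q - p * r) ^+ 2 by rewrite zz; ring.
by rewrite subr_le0 (le_trans _ (sqr_ge0 _)) // pmulr_rle0.
Qed.

End Atlas.

(** * Counting linear extensions by their initial words *)

Section Counting.

Context {d : Order.disp_t} {P : finPOrderType d}.
Implicit Types (p : seq P) (f : {ffun P -> 'I_#|P|}) (x y : P).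

Lemma linextP f :
  reflect [/\ injective f, forall k, exists x, f x = k &
              forall x y, (x < y)%O -> (f x < f y)%N] (f \in linexts P).
Proof.
rewrite inE; apply: (iffP and3P) => -[H1 H2 H3]; split.
- exact/injectiveP.
- by move=> k; have /forallP/(_ k)/codomP[x ->] := H2; exists x.
- by move=> x y lxy; move/forallP/(_ x)/forallP/(_ y)/implyP: H3; apply.
- exact/injectiveP.
- by apply/forallP => k; have [x <-] := H2 k; exact: codom_f.
- by apply/forallP => x; apply/forallP => y; apply/implyP; exact: H3.
Qed.

Definition starts_with p f := [seq (f x : nat) | x <- p] == iota 0 (size p).

Definition num_starting p : nat := #|[set f in linexts P | starts_with p f]|.

Lemma starts_with_rcons p x f :
  starts_with (rcons p x) f = starts_with p f && (f x == size p :> nat).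
Proof.
by rewrite /starts_with map_rcons size_rcons -addn1 iotaD cats1 eqseq_rcons.
Qed.

Lemma starts_with_index p f x : starts_with p f -> x \in p -> f x = index x p :> nat.
Proof.
move=> /eqP fp xp; have ip : (index x p < size p)%N by rewrite index_mem.
have := nth_map x 0%N (fun x => f x : nat) ip.
by rewrite fp nth_index // nth_iota.
Qed.

Lemma starts_with_mem p f x : injective f -> starts_with p f ->
  (f x < size p)%N -> x \in p.
Proof.
move=> f_inj /eqP fp fx; have := nth_map x 0%N (fun x => f x : nat) fx.
rewrite fp nth_iota // add0n => /val_inj/f_inj ->; exact: mem_nth.
Qed.

(** Exactly one element receives the value [size p], the next one since values start at 0. *)
Lemma num_starting_sum p : (size p < #|P|)%N ->
  num_starting p = (\sum_x num_starting (rcons p x))%N.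
Proof.
move=> ltp; rewrite /num_starting -sum1_card.
under [RHS]eq_bigr do rewrite -sum1_card.
rewrite (exchange_big_dep (mem [set f in linexts P | starts_with p f])) /=.
  apply: eq_bigr => f; rewrite inE => /andP[fl fp].
  have [f_inj f_surj _] := linextP _ fl; have [x fx] := f_surj (Ordinal ltp).
  rewrite (big_pred1 x) // => y; rewrite inE fl starts_with_rcons fp /=.
  by rewrite -(inj_eq f_inj) fx -val_eqE.
by move=> x f _; rewrite !inE starts_with_rcons => /and3P[-> ->].
Qed.

(** As [index x p = size p] for [x] outside [p], the inequality also forces [p] to list a
    down-set. *)
Definition admissible p :=
  uniq p /\ forall x y, (x < y)%O -> y \in p -> (index x p < index y p)%N.

Lemma admissible_rcons p x : admissible p -> x \in mins (~: [set y in p]) ->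
  admissible (rcons p x).
Proof.
move=> [up Hp] /minsP[]; rewrite !inE => xp xmin; split; first by rewrite rcons_uniq xp.
move=> y z ltyz; rewrite mem_rcons inE -cats1 !index_cat.
have [E|nzx] /= := eqVneq z x; last first.
  move=> zp; rewrite zp; have := Hp _ _ ltyz zp; case: ifP => // /negbT yp.
  by rewrite (memNindex yp) ltnNge index_size.
rewrite E (negPf xp) eqxx addn0; case: ifP => [|/negbT yp]; first by rewrite index_mem.
by have := xmin y; rewrite !inE yp -E ltyz => /(_ isT).
Qed.

Lemma num_starting0 p x : x \notin mins (~: [set y in p]) ->
  num_starting (rcons p x) = 0%N.
Proof.
move=> xN; apply/eqP; rewrite cards_eq0; apply/set0Pn => -[f].
rewrite inE starts_with_rcons => /and3P[/linextP[f_inj _ f_mono] fp /eqP fx].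
case/minsP: xN; rewrite !inE; split=> [|y].
  apply/negP => xp; have := starts_with_index fp xp; rewrite fx => e.
  by have := xp; rewrite -index_mem -e ltnn.
rewrite !inE; apply: contra => /f_mono; rewrite fx; exact: starts_with_mem.
Qed.

Lemma num_startingE p : admissible p ->
  (num_starting p)%:R = numext (~: [set x in p]).
Proof.
(* Induction on the number of elements still to be placed. When none is left, [index] is the only
   linear extension. *)
move E: (#|P| - size p)%N => k; elim: k p E => [|k IHk] p E [up Hp].
  have sp : size p = #|P|.
    by apply/eqP; rewrite eqn_leq -(card_uniqP up) max_card (card_uniqP up) -subn_eq0 E.
  have pT x : x \in p.
    have /setP/(_ x) : [set x in p] = setT.
      by apply/eqP; rewrite eqEcard subsetT cardsT cardsE (card_uniqP up) sp leqnn.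
    by rewrite !inE.
  have -> : ~: [set x in p] = set0 by apply/setP => x; rewrite !inE pT.
  rewrite numext0.
  have ltp x : (index x p < #|P|)%N by rewrite -sp index_mem.
  pose f := [ffun x => Ordinal (ltp x)].
  have f_inj : injective f.
    move=> x y /(congr1 val); rewrite !ffunE /= => exy.
    by rewrite -(nth_index x (pT x)) exy nth_index.
  rewrite /num_starting (_ : [set _ in _ | _] = [set f]) ?cards1 //.
  apply/setP => g; rewrite inE in_set1.
  apply/andP/eqP => [[_ gp]|->].
    by apply/ffunP => x; apply: val_inj; rewrite /= (starts_with_index gp) // ffunE.
  split.
    apply/linextP; split=> // [k|x y ltxy]; last by rewrite !ffunE /= Hp.
    have [|h _ hK] := inj_card_bij f_inj; first by rewrite card_ord.
    by exists (h k).
  apply/eqP/(@eq_from_nth _ 0%N) => [|i]; rewrite size_map ?size_iota // => ip.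
  pose x0 := tnth (in_tuple p) (Ordinal ip).
  by rewrite (nth_map x0) // nth_iota // ffunE /= index_uniq.
rewrite num_starting_sum; last by rewrite -subn_gt0 E.
rewrite numextE; last first.
  rewrite -card_gt0 cardsCs setCK cardsE (card_uniqP up).
  by rewrite E.
rewrite natr_sum [RHS]big_mkcond; apply: eq_bigr => x _.
case: ifPn => [xm|/num_starting0->//].
rewrite IHk; [|by rewrite size_rcons subnS E|exact: admissible_rcons].
congr numext; apply/setP => y; rewrite !inE mem_rcons inE negb_or //.
Qed.

Lemma num_starting2 x y : (num_starting [:: x; y])%:R =
  if (x \in mins setT) && (y \in mins (setT :\ x))
  then numext (setT :\ x :\ y) else 0.
Proof.
have setC1 : ~: [set z in [:: x]] = setT :\ x.
  by apply/setP => z; rewrite !inE andbT.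
have setC0 : ~: [set z in [::]] = setT :> {set P}.
  by apply/setP => z; rewrite !inE.
case: ifPn => [/andP[xm ym]|].
  have xa : admissible [:: x].
    by apply: (@admissible_rcons [::]); rewrite ?setC0.
  rewrite num_startingE; first congr numext.
    by apply/setP => z; rewrite !inE andbT negb_or andbC.
  by apply: (@admissible_rcons [:: x]); rewrite ?setC1.
rewrite negb_and => /orP[xm|ym].
  have := @num_starting0 [::] x; rewrite setC0 => /(_ xm) x0.
  apply/eqP; rewrite pnatr_eq0 -leqn0 -x0; apply/subset_leq_card/subsetP => f.
  by rewrite !inE (starts_with_rcons [:: x]) => /and3P[-> ->].
by rewrite (@num_starting0 [:: x]) ?setC1.
Qed.

Definition num12 (S T : {set P}) : nat :=
  #|[set f in linexts P | (1%N \in labels f S) && (2%N \in labels f T)]|.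

Lemma num12E (S T : {set P}) :
  num12 S T = (\sum_(x in S) \sum_(y in T) num_starting [:: x; y])%N.
Proof.
rewrite pair_big /= /num12 -sum1_card.
under [RHS]eq_bigr do rewrite /num_starting -sum1_card.
have labelP f k (U : {set P}) :
    reflect (exists2 x, x \in U & f x = k :> nat) (k.+1 \in labels f U).
  by apply: (iffP imageP) => -[x xU]; [case=> ->|move=> <-]; exists x.
pose Q := [set f in linexts P | (1%N \in labels f S) && (2%N \in labels f T)].
rewrite (exchange_big_dep (mem Q)) /=.
  apply: eq_bigr => f; rewrite inE => /and3P[fl /labelP[x xS fx] /labelP[y yT fy]].
  have [f_inj _ _] := linextP _ fl.
  have fE (z t : P) (k : nat) : f z = k :> nat -> (f t == k :> nat) = (t == z).
    by move=> <-; rewrite (inj_eq val_inj) (inj_eq f_inj).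
  rewrite (big_pred1 (x, y)) // => -[x' y'] /=.
  rewrite inE fl /starts_with /= !eqseq_cons andbT (fE _ _ _ fx) (fE _ _ _ fy).
  rewrite xpair_eqE.
  by apply: andb_idl => /andP[/eqP-> /eqP->]; rewrite xS yT.
move=> [x y] f /= /andP[xS yT]; rewrite !inE => /andP[-> /eqP[fx fy]] /=.
by apply/andP; split; apply/labelP; [exists x|exists y].
Qed.

Definition ind (S : {set P}) (x : P) : rat := (x \in S)%:R.

(** The hypothesis says that on the elements able to follow [x], the indicator of [T] is the
    transport of that of [V]. *)
Lemma num12_form (S T V : {set P}) : S \subset minimals P ->
  (forall x y, x \in S -> y \in mins (setT :\ x) ->
     (y \in T) = (if y \in minimals P then y \in V else x \in V)) ->
  (num12 S T)%:R = atlas_form setT (ind S) (ind V).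
Proof.
move=> sS HT; rewrite num12E natr_sum /atlas_form [RHS](bigID (mem S)) /=.
rewrite [X in _ = _ + X]big1 ?addr0; last first.
  by move=> x /andP[_ /negPf xS]; rewrite /ind xS mul0r.
apply: eq_big => [x|x xS].
  by rewrite minsT andb_idl // => /(subsetP sS).
rewrite natr_sum /ind xS mul1r /atlas_row big_mkcond [RHS]big_mkcond.
apply: eq_bigr => y _; rewrite num_starting2 minsT (subsetP sS _ xS) /=.
case: (boolP (y \in mins (setT :\ x))) => ym; last by rewrite if_same.
rewrite (HT _ _ xS ym) /transport minsT.
by case: (y \in minimals P); case: (_ \in V) => /=; rewrite ?mulr1 ?mulr0.
Qed.

(** An element freed by [x] in [A] is not in [B], and it inherits the value 0 that [ind B] takes at
    [x]. *)
Lemma num12_disjoint (A B : {set P}) : A \subset minimals P ->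
  B \subset minimals P -> [disjoint A & B] ->
  (num12 A B)%:R = atlas_form setT (ind A) (ind B).
Proof.
move=> sA sB dAB; apply: num12_form => // x y xA _.
rewrite (disjointFr dAB xA); case: ifPn => // yN.
by apply: contraNF yN; apply: (subsetP sB).
Qed.

(** An element freed by [x] in [C] lies above [x], while a minimal element is in the closure only if
    it is in [C]. *)
Lemma num12_up (C : {set P}) : C \subset minimals P ->
  (num12 C (upclosure C))%:R = atlas_form setT (ind C) (ind C).
Proof.
move=> sC; apply: num12_form => // x y xC ym; rewrite inE xC.
case: ifPn => [|yN].
  rewrite inE => /forallP ymin; apply/exists_inP/idP => [[s sC' les]|yC]; last by exists y.
  by have := ymin s; rewrite lt_def les andbT negbK => /eqP->.
apply/exists_inP; exists x => //; apply/ltW/(new_min_gt ym); by rewrite minsT.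
Qed.

Lemma form_ge0 S (u v : P -> rat) : (forall x, 0 <= u x) -> (forall x, 0 <= v x) ->
  0 <= atlas_form S u v.
Proof.
move=> u0 v0; apply: sumr_ge0 => x _; rewrite mulr_ge0 //.
apply: sumr_ge0 => y _; apply: mulr_ge0; first exact/ltW/numext_gt0.
by rewrite /transport; case: ifP.
Qed.

Lemma cross_ratioE (A B C : {set P}) :
  A \subset minimals P -> B \subset minimals P -> C \subset minimals P ->
  [disjoint A & B] -> [disjoint A & C] -> [disjoint B & C] ->
  let g (X Y : {set P}) := atlas_form setT (ind X) (ind Y) in
  cross_ratio A B C = g C C * g A B / (g A C * g B C).
Proof.
move=> sA sB sC dAB dAC dBC /=.
rewrite -num12_up // -!num12_disjoint // /cross_ratio /prob12 /prob.
rewrite -!/(num12 _ _); set N := #|linexts P|.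
(* If [N] were 0, all counts and hence both sides would be 0; otherwise the powers of [N] cancel. *)
have [N0|N0] := eqVneq N 0%N.
  have num0 S T : num12 S T = 0%N.
    apply/eqP; rewrite -leqn0 -N0; apply/subset_leq_card/subsetP => f.
    by rewrite inE => /andP[].
  by rewrite !num0 !mul0r.
have {}N0 : N%:R != 0 :> rat by rewrite pnatr_eq0.
rewrite !mulf_div invf_div mulf_div [_ * (N%:R * N%:R)]mulrC -mulf_div divff.
  by rewrite mul1r.
by rewrite mulf_neq0.
Qed.
End Counting.

(** * The two bounds on the cross ratio *)

Theorem theorem1p10 (d : Order.disp_t) (P : finPOrderType d)
    (A B C : {set P})
    (sA : A \subset minimals P) (sB : B \subset minimals P)
    (sC : C \subset minimals P)
    (A0 : A != set0) (B0 : B != set0) (C0 : C != set0)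
    (dAB : [disjoint A & B]) (dAC : [disjoint A & C])
    (dBC : [disjoint B & C]) :
  cross_ratio A B C <= 2 /\
  exists A' B' C' : {set P},
    perm_eq [:: A'; B'; C'] [:: A; B; C] /\ cross_ratio A' B' C' <= 1.
Proof.
have card2 : (1 < #|[set: P]|)%N.
  have [/set0Pn[a aA] /set0Pn[b bB]] := (A0, B0).
  apply: leq_trans (subset_leq_card (subsetT [set a; b])).
  rewrite cards2; case: eqVneq => // ab.
  by have := disjointFr dAB aA; rewrite ab bB.
pose g (X Y : {set P}) := atlas_form setT (ind X) (ind Y).
have g_ge0 X Y : 0 <= g X Y by apply: form_ge0 => x; apply: ler0n.
have gC X Y : g X Y = g Y X by apply: formC.
have gR X Y : g X X * g Y Y <= g X Y ^+ 2 by apply: form_hyperbolic card2 (g_ge0 Y Y).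
rewrite cross_ratioE // -!/(g _ _).
(* Division by zero gives 0, so a zero denominator makes the ratio 0. *)
have [ac0|ac0] := eqVneq (g A C * g B C) 0.
  split; first by rewrite ac0 invr0 mulr0.
  exists A, B, C; split=> //; by rewrite cross_ratioE // -!/(g _ _) ac0 invr0 mulr0.
move: ac0; rewrite mulf_eq0 negb_or => /andP[ac0 bc0].
have ac_gt0 : 0 < g A C by rewrite lt_def ac0 g_ge0.
have bc_gt0 : 0 < g B C by rewrite lt_def bc0 g_ge0.
have den_gt0 : 0 < g A C * g B C by rewrite mulr_gt0.
split.
  rewrite ler_pdivrMr //.
  (* The weights make both terms pair equally with [C]. *)
  pose u x := g B C * ind A x + g A C * ind B x.
  have uC : atlas_form setT u (ind C) = 2 * (g A C * g B C).
    by rewrite form_linear -/(g A C) -/(g B C); ring.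
  have uu : atlas_form setT u u = g B C ^+ 2 * g A A + 2 * (g A C * g B C) * g A B
      + g A C ^+ 2 * g B B.
    rewrite {1}/u form_linear ![atlas_form _ _ u]formC !form_linear -!/(g _ _) (gC B A).
    ring.
  have := form_hyperbolic u card2 (g_ge0 C C); rewrite uC uu -/(g C C) => h.
  rewrite -(ler_pM2l den_gt0) -(ler_pM2l (ltr0n rat 2)).
  (* Dropping these terms from [h] leaves [2 * x * (g C C * g A B) <= (2 * x) ^ 2] with
     [x = g A C * g B C]. *)
  have h1 : 0 <= (g B C ^+ 2 * g A A + g A C ^+ 2 * g B B) * g C C.
    by rewrite mulr_ge0 // addr_ge0 // mulr_ge0 // sqr_ge0.
  move: h h1; set x := g A C * g B C; nra.
have [le1|gt1] := lerP (g C C * g A B) (g A C * g B C).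
  by exists A, B, C; split=> //; rewrite cross_ratioE // -!/(g _ _) ler_pdivrMr // mul1r.
(* Now [A] takes the role of [C]. The goal is multiplied by [g A C * g B C], which [gt1] bounds by
   [g C C * g A B]. *)
exists B, C, A; split; first by rewrite (perm_rot 1 [:: A; B; C]).
rewrite cross_ratioE // 1?disjoint_sym // -!/(g _ _).
have ab_gt0 : 0 < g A B.
  rewrite lt_def g_ge0 andbT; apply: contraTneq gt1 => ->.
  by rewrite mulr0 -leNgt ltW.
rewrite (gC B A) (gC C A) ler_pdivrMr ?mulr_gt0 // mul1r.
rewrite -(ler_pM2l den_gt0).
apply: le_trans (_ : g C C * g A B * (g A A * g B C) <= _).
  by apply: ler_wpM2r; [rewrite mulr_ge0|exact: ltW].
have -> : g C C * g A B * (g A A * g B C) = g A A * g C C * (g A B * g B C) by ring.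
have -> : g A C * g B C * (g A B * g A C) = g A C ^+ 2 * (g A B * g B C) by ring.
by apply: ler_wpM2r; rewrite ?mulr_ge0.
Qed.
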